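(* Let $\mathscr{A}$ be a unital $C^*$-algebra, let $\mathscr{H}$ be a complex Hilbert space, and let $\Phi:\mathscr{A}\to\mathbb{B}(\mathscr{H})$ be a unital $n$-positive linear map for some integer $n\geq 3$. Then $$\|\Phi(AB)-\Phi(A)\Phi(B)\|\leq \Delta(A,\|\cdot\|)\,\Delta(B,\|\cdot\|)$$ for all $A,B\in\mathscr{A}$.
   Context: $\mathbb{B}(\mathscr{H})$ is the $C^*$-algebra of all bounded linear operators on $\mathscr{H}$, and $\|\cdot\|$ denotes the operator norm (the $C^*$-norm). For an element $C$ of a unital $C^*$-algebra with identity $I$, $\Delta(C,\|\cdot\|)=\inf_{\lambda\in\mathbb{C}}\|C-\lambda I\|$ is the norm distance of $C$ from the scalar multiples of the identity. A linear map $\Phi:\mathscr{A}\to\mathscr{B}$ between $C^*$-algebras is positive if $\Phi(A)\geq 0$ whenever $A\geq 0$; it is $n$-positive if the map $\Phi_n:M_n(\mathscr{A})\to M_n(\mathscr{B})$, $\Phi_n([a_{ij}])=[\Phi(a_{ij})]$, is positive, where $M_n(\mathscr{A})$ is the $C^*$-algebra of $n\times n$ matrices with entries in $\mathscr{A}$. It is unital if it maps the identity to the identity. *)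

(* Defs.v *)
From HB Require Import structures.
From mathcomp Require Import all_boot all_order all_algebra.
From mathcomp Require Import sesquilinear complex.
From mathcomp Require Import all_classical all_reals all_analysis.
From mathcomp Require Import ring lra.

Set Implicit Arguments.
Unset Strict Implicit.
Unset Printing Implicit Defensive.

Import Order.TTheory GRing.Theory Num.Theory.
Import numFieldNormedType.Exports.

Local Open Scope classical_set_scope.
Local Open Scope complex_scope.
Local Open Scope ring_scope.

HB.mixin Record PzRing_hasStar A & GRing.PzRing A := {
  star : A -> A;
  starK : involutive star;
  starD : {morph star : x y / x + y};
  starM : forall x y, star (x * y) = star y * star x
}.
#[short(type="starRingType")]
HB.structure Definition StarRing := {A of GRing.PzRing A & PzRing_hasStar A}.

Section MatrixStar.
Variables (A : starRingType) (n : nat).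

Definition mxstar (X : 'M[A]_n) : 'M[A]_n := (map_mx star X)^T.

Lemma star0 : star 0 = 0 :> A.
Proof. by apply: (addrI (star 0)); rewrite -starD !addr0. Qed.

Lemma star_sum I r (P : pred I) (F : I -> A) :
  star (\sum_(i <- r | P i) F i) = \sum_(i <- r | P i) star (F i).
Proof. exact: (big_morph _ (@starD A) star0). Qed.

Fact mxstarK : involutive mxstar.
Proof. by move=> X; apply/matrixP => i j; rewrite !mxE starK. Qed.
Fact mxstarD : {morph mxstar : X Y / X + Y}.
Proof. by move=> X Y; apply/matrixP => i j; rewrite !mxE starD. Qed.
Fact mxstarM X Y : mxstar (X * Y) = mxstar Y * mxstar X.
Proof.
apply/matrixP => i j; rewrite !mxE star_sum; apply: eq_bigr => k _.
by rewrite !mxE starM.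
Qed.
HB.instance Definition _ :=
  PzRing_hasStar.Build 'M[A]_n mxstarK mxstarD mxstarM.
End MatrixStar.

HB.mixin Record isCStarAlgebra (R : realType) A & StarRing A := {
  alg_scale : R[i] -> A -> A;
  alg_scaleA : forall k l x, alg_scale k (alg_scale l x) = alg_scale (k * l) x;
  alg_scale1 : left_id 1 alg_scale;
  alg_scaleDr : right_distributive alg_scale +%R;
  alg_scaleDl : forall x, {morph alg_scale^~ x : k l / k + l};
  alg_scaleAl : forall l (x y : A), alg_scale l (x * y) = alg_scale l x * y;
  alg_scaleAr : forall l (x y : A), alg_scale l (x * y) = x * alg_scale l y;
  star_alg_scale : forall l x, star (alg_scale l x) = alg_scale l^*%C (star x);
  cnorm : A -> R;
  cnormD : forall x y, cnorm (x + y) <= cnorm x + cnorm y;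
  cnorm_alg_scale : forall l x, cnorm (alg_scale l x) = complex.Re `|l| * cnorm x;
  cnorm0_eq0 : forall x, cnorm x = 0 -> x = 0;
  cnormM : forall x y, cnorm (x * y) <= cnorm x * cnorm y;
  cnorm_starM : forall x, cnorm (star x * x) = cnorm x ^+ 2;
  cnorm_complete : forall u : nat -> A,
    (forall e : R, 0 < e -> exists N, forall m n : nat,
      (N <= m)%N -> (N <= n)%N -> cnorm (u m - u n) < e) ->
    exists x, cnorm (u n - x) @[n --> \oo] --> (0 : R)
}.
#[short(type="cstarAlgType")]
HB.structure Definition CStarAlgebra (R : realType) :=
  {A of StarRing A & isCStarAlgebra R A}.

(* The library's algType only allows algebras with 1 != 0, and a structure
   joining pzRingType and lmodType cannot be declared outside it; the scaling is
   therefore a field above, and lmodType is inherited through this instance.  The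
   zero algebra has to be covered, since it is B(H) for H = 0. *)
#[non_forgetful_inheritance]
HB.instance Definition _ (R : realType) (A : cstarAlgType R) :=
  GRing.Zmodule_isLmodule.Build R[i] A
    (@alg_scaleA R A) (@alg_scale1 R A) (@alg_scaleDr R A) (@alg_scaleDl R A).

Section CStarTheory.
Variables (R : realType) (A : cstarAlgType R).
Implicit Types (l : R[i]) (x y : A).

Lemma cscalerAl l x y : l *: (x * y) = (l *: x) * y.
Proof. exact: alg_scaleAl. Qed.
Lemma cscalerAr l x y : l *: (x * y) = x * (l *: y).
Proof. exact: alg_scaleAr. Qed.
Lemma starZ l x : star (l *: x) = l^*%C *: star x.
Proof. exact: star_alg_scale. Qed.
Lemma cnormZ l x : cnorm (l *: x) = complex.Re `|l| * cnorm x.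
Proof. exact: cnorm_alg_scale. Qed.
End CStarTheory.

(* In a C*-algebra the positive elements are those of the form b^* b.  This
   involves only the *-ring structure, so it also applies to M_n(A), with the
   conjugate transpose as star, without its C*-norm. *)
Definition positive (A : starRingType) (a : A) : Prop :=
  exists b : A, a = star b * b.

Definition positive_map (A B : starRingType) (f : A -> B) : Prop :=
  forall a, positive a -> positive (f a).

Definition n_positive (n : nat) (A B : starRingType) (f : A -> B) : Prop :=
  positive_map (map_mx f : 'M[A]_n -> 'M[B]_n).

Definition Delta (R : realType) (A : cstarAlgType R) (a : A) : R :=
  inf [set cnorm (a - l *: (1 : A)) | l in [set: R[i]]].

(* {dot H for conj} is linear in the first argument, conjugate-linear in the
   second. *)
HB.mixin Record isHilbert (R : realType) H & CompleteNormedModule R[i] H := {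
  inner : {dot H for (@Num.conj R[i])};
  inner_norm : forall x : H, `|x| ^+ 2 = inner x x
}.
#[short(type="hilbertType")]
HB.structure Definition Hilbert (R : realType) :=
  {H of CompleteNormedModule R[i] H & isHilbert R H}.

Section HilbertTheory.
Variables (R : realType) (H : hilbertType R).
Implicit Types (x y z : H) (l : R[i]).

Lemma ReD (a b : R[i]) : complex.Re (a + b) = complex.Re a + complex.Re b.
Proof. by case: a b => [? ?] [? ?]. Qed.
Lemma ReZ (r : R) (a : R[i]) : complex.Re (r%:C * a) = r * complex.Re a.
Proof. by case: a => [? ?] /=; rewrite mul0r subr0. Qed.
Lemma Re_norm_real (r : R) : complex.Re `|r%:C| = `|r|.
Proof. by rewrite normc_def /= expr0n /= addr0 sqrtr_sqr. Qed.

Definition hnorm (x : H) : R := complex.Re `|x|.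

Lemma hnormE x : `|x| = (hnorm x)%:C.
Proof. by apply/esym/RRe_real/ger0_real. Qed.

Lemma hnorm_ge0 x : 0 <= hnorm x.
Proof. by rewrite -ler0c -hnormE. Qed.

Lemma hnorm_triangle x y : hnorm (x + y) <= hnorm x + hnorm y.
Proof. by rewrite -lecR rmorphD/= -!hnormE ler_normD. Qed.

Lemma hnormZ l x : hnorm (l *: x) = complex.Re `|l| * hnorm x.
Proof.
by rewrite /hnorm normrZ (hnormE x) mulrC ReZ mulrC.
Qed.

Lemma hnorm0_eq0 x : hnorm x = 0 -> x = 0.
Proof. by move=> x0; apply/normr0_eq0; rewrite hnormE x0. Qed.

Lemma hnorm_opp x : hnorm (- x) = hnorm x.
Proof. by rewrite /hnorm normrN. Qed.

Lemma hnorm0 : hnorm 0 = 0.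
Proof. by rewrite /hnorm normr0. Qed.

Lemma innerDl x y z : inner (x + y) z = inner x z + inner y z.
Proof. exact: linearDl. Qed.
Lemma innerZl l x y : inner (l *: x) y = l * inner x y.
Proof. exact: linearZl_LR. Qed.
Lemma innerC x y : inner x y = (inner y x)^*%C.
Proof. by rewrite hermC expr0 mul1r. Qed.
Lemma innerDr x y z : inner x (y + z) = inner x y + inner x z.
Proof. exact: linearDr. Qed.
Lemma innerZr l x y : inner x (l *: y) = l^*%C * inner x y.
Proof. exact: linearZr_LR. Qed.

Definition reinner x y : R := complex.Re (inner x y).

Lemma reC x y : reinner x y = reinner y x.
Proof. by rewrite /reinner innerC; case: (inner y x). Qed.
Lemma reDl x y z : reinner (x + y) z = reinner x z + reinner y z.
Proof. by rewrite /reinner innerDl ReD. Qed.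
Lemma reZl (r : R) x y : reinner (r%:C *: x) y = r * reinner x y.
Proof. by rewrite /reinner innerZl ReZ. Qed.
Lemma reDr x y z : reinner x (y + z) = reinner x y + reinner x z.
Proof. by rewrite /reinner innerDr ReD. Qed.
Lemma reZr (r : R) x y : reinner x (r%:C *: y) = r * reinner x y.
Proof. by rewrite reC reZl reC. Qed.
Lemma reNr x y : reinner x (- y) = - reinner x y.
Proof. by rewrite -scaleN1r (_ : -1 = (-1)%:C) ?reZr ?mulN1r// rmorphN1. Qed.
Lemma reNl x y : reinner (- x) y = - reinner x y.
Proof. by rewrite reC reNr reC. Qed.
Lemma re_norm x : reinner x x = hnorm x ^+ 2.
Proof.
by rewrite /reinner -inner_norm hnormE -rmorphXn.
Qed.

Lemma re_CS x y : reinner x y <= hnorm x * hnorm y.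
Proof.
have [x0|x0] := eqVneq (hnorm x) 0.
  rewrite x0 (hnorm0_eq0 x0) mul0r.
  by rewrite -(scale0r x) (_ : 0 = 0%:C) // reZl mul0r.
have [y0|y0] := eqVneq (hnorm y) 0.
  rewrite y0 (hnorm0_eq0 y0) mulr0.
  by rewrite -(scale0r x) (_ : 0 = 0%:C) // reZr mul0r.
have xy0 : 0 < hnorm x * hnorm y.
  by rewrite mulr_gt0// lt_neqAle hnorm_ge0 eq_sym ?x0 ?y0.
have := sqr_ge0 (hnorm ((hnorm y)%:C *: x - (hnorm x)%:C *: y)).
rewrite -re_norm !(reDl, reDr, reNl, reNr, reZl, reZr) !re_norm (reC y x).
rewrite [X in 0 <= X -> _](_ : _ = 2 * (hnorm x * hnorm y) *
  (hnorm x * hnorm y - reinner x y)); last by ring.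
by rewrite pmulr_rge0 ?subr_ge0// mulr_gt0.
Qed.

Lemma re_CS_norm x y : `|reinner x y| <= hnorm x * hnorm y.
Proof.
by rewrite ler_norml lerNl -reNl -{1}(hnorm_opp x) !re_CS.
Qed.

Lemma re_eq (f g : H -> R[i]) :
  (forall l x, f (l *: x) = l * f x) -> (forall l x, g (l *: x) = l * g x) ->
  (forall x, complex.Re (f x) = complex.Re (g x)) -> f =1 g.
Proof.
move=> fZ gZ fg x; have := fg ('i%C *: x); have := fg x.
rewrite fZ gZ; case: (f x) (g x) => [a b] [c d] /= -> bd; congr Complex.
by move: bd; rewrite !mul0r !mul1r !sub0r => /oppr_inj.
Qed.

Lemma inner_inj z z' : (forall x, inner x z = inner x z') -> z = z'.
Proof.
move=> zz'; apply/subr0_eq/hnorm0_eq0/eqP; rewrite -sqrf_eq0 -re_norm.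
by rewrite [in X in reinner _ X]/GRing.add/= reDr reNr /reinner zz' subrr.
Qed.

Lemma posC (e : R[i]) : 0 < e -> exists2 r : R, 0 < r & e = r%:C.
Proof.
move=> e0; exists (complex.Re e); last by rewrite RRe_real// gtr0_real.
by rewrite -ltcR RRe_real// gtr0_real.
Qed.

Lemma ball_hnorm x y (r : R) : ball x r%:C y <-> hnorm (x - y) < r.
Proof. by rewrite -ball_normE /ball_ /= hnormE ltcR. Qed.

Lemma hilbert_complete (u : nat -> H) :
  (forall e : R, 0 < e -> exists N, forall m n : nat,
    (N <= m)%N -> (N <= n)%N -> hnorm (u m - u n) < e) ->
  exists z, forall e : R, 0 < e -> exists N, forall n : nat,
    (N <= n)%N -> hnorm (u n - z) < e.
Proof.
move=> uc; have Fc : cauchy (u @ \oo).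
  apply: cauchy_exP => e /posC[r /uc[N uN] ->]; exists (u N), N => // n Nn.
  by apply/ball_hnorm/uN => //; exact: leqnn.
have /cvg_ex[/= z uz] : cvg (u @ \oo) by exact: cauchy_cvg.
exists z => e e0; have : (u @ \oo) (ball z e%:C).
  by apply: uz; apply: nbhsx_ballx; rewrite ltcR.
move=> [N _ uN]; exists N => n /uN /ball_hnorm.
by rewrite -hnorm_opp opprB.
Qed.

Section Riesz.
Variables (f : H -> R[i]) (M : R).
Hypothesis fD : forall x y, f (x + y) = f x + f y.
Hypothesis fZ : forall l x, f (l *: x) = l * f x.
Hypothesis fM : forall x, complex.Re (f x) <= M * hnorm x.

Let q x := hnorm x ^+ 2 - 2 * complex.Re (f x).
Let Q := [set q x | x in [set: H]].
Let m := inf Q.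
Let S (e : R) := [set x | q x < m + e].

Let q_lb x : - M ^+ 2 <= q x.
Proof. by have := fM x; have := sqr_ge0 (hnorm x - M); rewrite /q; nra. Qed.

Let Q_inf : has_inf Q.
Proof.
split; first by exists (q 0), 0.
by exists (- M ^+ 2) => _ [x _ <-]; exact: q_lb.
Qed.

Let m_le x : m <= q x.
Proof. by apply: ge_inf; [case: Q_inf|exists x]. Qed.

Let S_ex e : 0 < e -> exists x, S e x.
Proof.
move=> e0; have [_ [x _ <-] ?] := inf_adherent e0 Q_inf.
by exists x.
Qed.

Let q_move (t : R) x v : q (x + t%:C *: v) =
  q x + 2 * t * (reinner v x - complex.Re (f v)) + t ^+ 2 * hnorm v ^+ 2.
Proof.
rewrite /q -!re_norm fD fZ ReD ReZ !(reDl, reDr, reZl, reZr) (reC x v).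
by ring.
Qed.

Let S_small e x y : S e x -> S e y -> hnorm (x - y) ^+ 2 <= 4 * e.
Proof.
rewrite /S /= => Sx Sy; have := m_le ((2^-1)%:C *: x + (2^-1)%:C *: y).
move: Sx Sy; rewrite /q -!re_norm !fD !fZ !ReD !ReZ.
rewrite !(reDl, reDr, reNl, reNr, reZl, reZr) (reC y x).
by lra.
Qed.

Let F := filter_from [set e : R | 0 < e] S.

Let F_filter : ProperFilter F.
Proof.
apply: filter_from_proper => [|e /= /S_ex//].
apply: filter_from_filter; first by exists 1 => /=.
move=> i j /= i0 j0; exists (Num.min i j); first by rewrite /= lt_min i0.
by move=> x; rewrite /S /= => h; split; apply: (lt_le_trans h);
  rewrite lerD2l ge_min lexx ?orbT.
Qed.

Let F_cvg : cvg F.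
Proof.
have FF : Filter F by exact: (@filter_filter _ _ F_filter).
suff Fc : cauchy F by exact: cauchy_cvg.
apply/(@cauchy_exP _ _ _ FF) => e /posC[r r0 ->].
have e0 : 0 < r ^+ 2 / 8 by rewrite divr_gt0// exprn_gt0.
have [x Sx] := S_ex e0; exists x, (r ^+ 2 / 8) => // y Sy; apply/ball_hnorm.
rewrite -(ltr_pXn2r (n := 2))// ?nnegrE ?hnorm_ge0 ?(ltW r0)//.
apply: (le_lt_trans (S_small Sx Sy)).
by have := exprn_gt0 2 r0; lra.
Qed.

Lemma riesz : exists z, forall x, f x = inner x z.
Proof.
have /cvg_ex[/= z Fz] := F_cvg; exists z; apply: re_eq => //.
  by move=> l x; rewrite innerZl.
move=> v; apply/eqP; rewrite eq_sym -subr_eq0 -/(reinner v z); apply/eqP.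
set G := _ - _; set N := hnorm v ^+ 2.
have N0 : 0 <= N by exact: sqr_ge0.
have approx e d : 0 < e -> 0 < d -> exists2 x, q x < m + e & hnorm (z - x) < d.
  move=> e0 d0.
  have FS : F (S e) by exists e.
  have Fb : F (ball z d%:C) by apply: Fz; apply: nbhsx_ballx; rewrite ltcR.
  have [x [Sx /ball_hnorm bx]] :=
    @filter_ex _ _ F_filter _ (@filterI _ _ F_filter _ _ FS Fb).
  by exists x.
have pos t : 0 <= 2 * t * G + t ^+ 2 * N.
  apply/ler_addgt0Pr => e e0.
  pose D := `|t| * hnorm v + 1.
  have D0 : 0 < D by rewrite ltr_wpDl// mulr_ge0// hnorm_ge0.
  have [x qx zx] := approx (e / 2) (e / (4 * D)) (divr_gt0 e0 (ltr0Sn _ _))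
    (divr_gt0 e0 (mulr_gt0 (ltr0Sn _ _) D0)).
  have := m_le (x + t%:C *: v); rewrite q_move -/N.
  have -> : reinner v x - complex.Re (f v) = G - reinner v (z - x).
    by rewrite /G reDr reNr; lra.
  have : - (2 * t * reinner v (z - x)) <= e / 2.
    apply: (le_trans (ler_norm _)).
    rewrite normrN !normrM (@ger0_norm _ 2)//.
    apply: (@le_trans _ _ (2 * `|t| * (hnorm v * (e / (4 * D))))).
      apply: ler_wpM2l; first by rewrite mulr_ge0.
      apply: (le_trans (re_CS_norm _ _)); apply: ler_wpM2l; first exact: hnorm_ge0.
      exact: ltW.
    have -> : 2 * `|t| * (hnorm v * (e / (4 * D))) =
      e / 2 * ((`|t| * hnorm v) / D) by field; rewrite gt_eqF.
    rewrite ler_piMr//; first by rewrite divr_ge0// ltW.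
    by rewrite ler_pdivrMr// mul1r /D lerDl.
  by lra.
have N1 : N + 1 != 0 by rewrite gt_eqF// ltr_wpDl.
have := pos (- G / (N + 1)).
have -> : 2 * (- G / (N + 1)) * G + (- G / (N + 1)) ^+ 2 * N =
  - (G ^+ 2 * (N + 2) / (N + 1) ^+ 2) by field.
rewrite oppr_ge0 => h.
apply/eqP; rewrite -sqrf_eq0; apply/eqP/le_anti; rewrite sqr_ge0 andbT.
move: h; rewrite pmulr_lle0; last by rewrite invr_gt0 exprn_even_gt0.
by rewrite pmulr_lle0// ltr_wpDl.
Qed.
End Riesz.
End HilbertTheory.

Definition bounded_linear (R : realType) (H : hilbertType R) (T : H -> H) :=
  linear T /\ exists M : R, forall x, hnorm (T x) <= M * hnorm x.

Record bounded_op (R : realType) (H : hilbertType R) := BoundedOp {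
  bop_fun :> H -> H;
  bop_bounded_linear : bounded_linear bop_fun
}.

Notation "''B(' H )" := (bounded_op H) (at level 8, format "''B(' H )").

Section BoundedOp.
Variables (R : realType) (H : hilbertType R).
Implicit Types (S T U : 'B(H)) (x y z : H) (l : R[i]).

Lemma bopP S T : S =1 T -> S = T.
Proof.
case: S T => [S Sb] [T Tb] /= /funext ST; case: _ / ST in Tb *.
by congr BoundedOp; exact: Prop_irrelevance.
Qed.

Lemma bopD T x y : T (x + y) = T x + T y.
Proof.
by have [Tl _] := bop_bounded_linear T; have := Tl 1 x y; rewrite !scale1r.
Qed.

Lemma bop0 T : T 0 = 0.
Proof. by apply: (addrI (T 0)); rewrite -bopD !addr0. Qed.

Lemma bopZ T l x : T (l *: x) = l *: T x.
Proof.
have [Tl _] := bop_bounded_linear T.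
by have := Tl l x 0; rewrite !addr0 bop0 addr0.
Qed.

Lemma bop_bound T : exists2 M : R, 0 <= M & forall x, hnorm (T x) <= M * hnorm x.
Proof.
have [_ [M TM]] := bop_bounded_linear T; exists `|M| => // x.
by apply: (le_trans (TM x)); rewrite ler_wpM2r ?hnorm_ge0// ler_norm.
Qed.

Fact zero_bounded : bounded_linear (fun=> 0 : H).
Proof.
split; first by move=> l x y; rewrite scaler0 addr0.
by exists 0 => x; rewrite hnorm0 mul0r.
Qed.

Fact add_bounded S T : bounded_linear (fun x => S x + T x).
Proof.
split; first by move=> l x y; rewrite !bopD !bopZ scalerDr addrACA.
have [M _ SM] := bop_bound S; have [N _ TN] := bop_bound T; exists (M + N) => x.
by rewrite mulrDl; apply: (le_trans (hnorm_triangle _ _)); rewrite lerD.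
Qed.

Fact scale_bounded l T : bounded_linear (fun x => l *: T x).
Proof.
split; first by move=> k x y; rewrite bopD bopZ scalerDr !scalerA mulrC.
have [M _ TM] := bop_bound T; exists (complex.Re `|l| * M) => x.
rewrite hnormZ -mulrA; apply: ler_wpM2l => //.
by rewrite -ler0c RRe_real// ger0_real.
Qed.

Fact id_bounded : bounded_linear (id : H -> H).
Proof. by split => //; exists 1 => x; rewrite mul1r. Qed.

Fact comp_bounded S T : bounded_linear (fun x => S (T x)).
Proof.
split; first by move=> l x y; rewrite !(bopD, bopZ).
have [M M0 SM] := bop_bound S; have [N _ TN] := bop_bound T; exists (M * N) => x.
by apply: (le_trans (SM _)); rewrite -mulrA; exact: ler_wpM2l.
Qed.

Let add S T := BoundedOp (add_bounded S T).
Let scale l T := BoundedOp (scale_bounded l T).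
Let mul S T := BoundedOp (comp_bounded S T).

Fact bop_addA : associative add.
Proof. by move=> ? ? ?; apply: bopP => x /=; rewrite addrA. Qed.
Fact bop_addC : commutative add.
Proof. by move=> ? ?; apply: bopP => x /=; rewrite addrC. Qed.
Fact bop_add0 : left_id (BoundedOp zero_bounded) add.
Proof. by move=> ?; apply: bopP => x /=; rewrite add0r. Qed.
Fact bop_addN : left_inverse (BoundedOp zero_bounded) (scale (- 1)) add.
Proof. by move=> ?; apply: bopP => x /=; rewrite scaleN1r addNr. Qed.

HB.instance Definition _ := gen_eqMixin 'B(H).
HB.instance Definition _ := gen_choiceMixin 'B(H).
HB.instance Definition _ :=
  GRing.isZmodule.Build 'B(H) bop_addA bop_addC bop_add0 bop_addN.

Fact bop_mulA : associative mul.
Proof. by move=> ? ? ?; apply: bopP. Qed.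
Fact bop_mul1 : left_id (BoundedOp id_bounded) mul.
Proof. by move=> ?; apply: bopP. Qed.
Fact bop_mulr1 : right_id (BoundedOp id_bounded) mul.
Proof. by move=> ?; apply: bopP. Qed.
Fact bop_mulDl : left_distributive mul +%R.
Proof. by move=> ? ? ?; apply: bopP. Qed.
Fact bop_mulDr : right_distributive mul +%R.
Proof. by move=> ? ? ?; apply: bopP => x /=; rewrite bopD. Qed.
HB.instance Definition _ := GRing.Zmodule_isPzRing.Build 'B(H)
  bop_mulA bop_mul1 bop_mulr1 bop_mulDl bop_mulDr.

Fact bop_scaleA k l T : scale k (scale l T) = scale (k * l) T.
Proof. by apply: bopP => x /=; rewrite scalerA. Qed.
Fact bop_scale1 : left_id 1 scale.
Proof. by move=> ?; apply: bopP => x /=; rewrite scale1r. Qed.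
Fact bop_scaleDr : right_distributive scale +%R.
Proof. by move=> ? ? ?; apply: bopP => x /=; rewrite scalerDr. Qed.
Fact bop_scaleDl T : {morph scale^~ T : k l / k + l}.
Proof. by move=> ? ?; apply: bopP => x /=; rewrite scalerDl. Qed.
HB.instance Definition _ := GRing.Zmodule_isLmodule.Build R[i] 'B(H)
  bop_scaleA bop_scale1 bop_scaleDr bop_scaleDl.

Fact bop_scaleAl l S T : l *: (S * T) = (l *: S) * T.
Proof. by apply: bopP. Qed.
Fact bop_scaleAr l S T : l *: (S * T) = S * (l *: T).
Proof. by apply: bopP => x /=; rewrite bopZ. Qed.

Lemma bopDE S T x : (S + T) x = S x + T x. Proof. by []. Qed.
Lemma bopZE l T x : (l *: T) x = l *: T x. Proof. by []. Qed.
Lemma bopNE T x : (- T) x = - T x. Proof. exact: scaleN1r. Qed.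
Lemma bopME S T x : (S * T) x = S (T x). Proof. by []. Qed.
Lemma bop1E x : (1 : 'B(H)) x = x. Proof. by []. Qed.

(* The set below is a singleton, see adjoint_funP and inner_inj. *)
Definition adjoint_fun T (y : H) : H :=
  xget 0 [set z | forall x, inner (T x) y = inner x z].

Lemma adjoint_funP T x y : inner (T x) y = inner x (adjoint_fun T y).
Proof.
have [M M0 TM] := bop_bound T.
have [z Tz] : exists z, forall x, inner (T x) y = inner x z.
  apply: (@riesz _ _ (fun x => inner (T x) y) (M * hnorm y)) => [? ?|? ?|v].
  - by rewrite bopD innerDl.
  - by rewrite bopZ innerZl.
  - apply: (le_trans (re_CS _ _)).
    by rewrite mulrAC ler_wpM2r ?hnorm_ge0.
exact: (@xgetPex _ 0 [set z | forall x, inner (T x) y = inner x z]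
  (ex_intro _ z Tz)).
Qed.

Fact adjoint_bounded T : bounded_linear (adjoint_fun T).
Proof.
split => [l y z|].
  apply: inner_inj => x; rewrite -adjoint_funP !innerDr !innerZr.
  by rewrite !adjoint_funP.
have [M M0 TM] := bop_bound T; exists M => y.
have [->|y0] := eqVneq (hnorm (adjoint_fun T y)) 0.
  by rewrite mulr_ge0 ?hnorm_ge0.
have {}y0 : 0 < hnorm (adjoint_fun T y) by rewrite lt_neqAle hnorm_ge0 eq_sym y0.
rewrite -(ler_pM2l y0) -expr2 -re_norm /reinner -adjoint_funP.
apply: (le_trans (re_CS _ _)).
by rewrite mulrCA mulrA ler_wpM2r ?hnorm_ge0.
Qed.

Definition adjoint T : 'B(H) := BoundedOp (adjoint_bounded T).

Lemma adjointP T x y : inner (T x) y = inner x (adjoint T y).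
Proof. exact: adjoint_funP. Qed.

Lemma adjointPr T x y : inner x (T y) = inner (adjoint T x) y.
Proof. by rewrite innerC adjointP -innerC. Qed.

Fact adjointK : involutive adjoint.
Proof.
by move=> T; apply: bopP => y; apply: inner_inj => x; rewrite -adjointP adjointPr.
Qed.

Fact adjointD : {morph adjoint : S T / S + T}.
Proof.
move=> S T; apply: bopP => y; apply: inner_inj => x.
by rewrite -adjointP !bopDE innerDl innerDr !adjointP.
Qed.

Fact adjointM S T : adjoint (S * T) = adjoint T * adjoint S.
Proof.
apply: bopP => y; apply: inner_inj => x.
by rewrite -adjointP !bopME !adjointP.
Qed.
HB.instance Definition _ :=
  PzRing_hasStar.Build 'B(H) adjointK adjointD adjointM.

Fact adjointZ l T : star (l *: T) = l^*%C *: star T.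
Proof.
apply: bopP => y; apply: inner_inj => x.
rewrite -adjointP !bopZE innerZl innerZr adjointP.
by rewrite conjcK.
Qed.

Definition opnorm T : R := sup [set hnorm (T x) | x in [set x | hnorm x <= 1]].

Lemma opnorm_le T M :
  0 <= M -> (forall x, hnorm (T x) <= M * hnorm x) -> opnorm T <= M.
Proof.
move=> M0 TM; apply: ge_sup => [|_ [x /= x1 <-]]; last first.
  by apply: (le_trans (TM x)); rewrite ler_piMr.
by exists (hnorm (T 0)), 0; rewrite //= hnorm0.
Qed.

Lemma opnorm_ub T x : hnorm (T x) <= opnorm T * hnorm x.
Proof.
have [->|x0] := eqVneq x 0; first by rewrite bop0 hnorm0 mulr0.
have {}x0 : 0 < hnorm x.
  by rewrite lt_neqAle hnorm_ge0 andbT eq_sym; apply: contra_neq x0 => /hnorm0_eq0.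
have x1 : complex.Re `|((hnorm x)^-1)%:C| = (hnorm x)^-1.
  by rewrite Re_norm_real ger0_norm// invr_ge0 ltW.
rewrite -ler_pdivrMr// mulrC -x1 -hnormZ -bopZ.
have [M M0 TM] := bop_bound T.
apply: ub_le_sup.
  exists M => _ [y /= y1 <-].
  by apply: (le_trans (TM y)); rewrite ler_piMr.
exists (((hnorm x)^-1)%:C *: x) => //=.
by rewrite hnormZ x1 mulVf ?gt_eqF.
Qed.

Lemma opnorm_ge0 T : 0 <= opnorm T.
Proof.
have [M M0 TM] := bop_bound T.
apply: (le_trans (hnorm_ge0 (T 0))); apply: ub_le_sup.
  exists M => _ [y /= y1 <-].
  by apply: (le_trans (TM y)); rewrite ler_piMr.
by exists 0; rewrite //= hnorm0.
Qed.

Fact opnormD S T : opnorm (S + T) <= opnorm S + opnorm T.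
Proof.
apply: opnorm_le => [|x]; first by rewrite addr_ge0 ?opnorm_ge0.
by rewrite mulrDl; apply: (le_trans (hnorm_triangle _ _)); rewrite lerD ?opnorm_ub.
Qed.

Let Re_norm_ge0 l : 0 <= complex.Re `|l|.
Proof. by rewrite -ler0c RRe_real// ger0_real. Qed.

Let opnormZ_le l T : opnorm (l *: T) <= complex.Re `|l| * opnorm T.
Proof.
apply: opnorm_le => [|x]; first by rewrite mulr_ge0 ?opnorm_ge0.
by rewrite bopZE hnormZ -mulrA ler_wpM2l ?opnorm_ub.
Qed.

Fact opnormZ l T : opnorm (l *: T) = complex.Re `|l| * opnorm T.
Proof.
apply/le_anti; rewrite opnormZ_le andTb.
have [->|l0] := eqVneq l 0; first by rewrite normr0 mul0r opnorm_ge0.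
have := opnormZ_le l^-1 (l *: T); rewrite scalerA mulVf// scale1r.
have l1 : 0 < complex.Re `|l| by rewrite -ltcR RRe_real ?normr_gt0// ger0_real.
have -> : complex.Re `|l^-1| = (complex.Re `|l|)^-1.
  apply: (mulfI (lt0r_neq0 l1)); rewrite mulfV ?gt_eqF//.
  have -> : complex.Re `|l| * complex.Re `|l^-1| = complex.Re (`|l| * `|l^-1|).
    by rewrite -ReZ RRe_real// ger0_real.
  by rewrite -normrM mulfV// normr1.
by rewrite ler_pdivlMl.
Qed.

Fact opnorm0_eq0 T : opnorm T = 0 -> T = 0.
Proof.
move=> T0; apply: bopP => x; apply: hnorm0_eq0; apply/le_anti.
by rewrite hnorm_ge0 andbT (le_trans (opnorm_ub T x))// T0 mul0r.
Qed.

Fact opnormM S T : opnorm (S * T) <= opnorm S * opnorm T.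
Proof.
apply: opnorm_le => [|x]; first by rewrite mulr_ge0 ?opnorm_ge0.
rewrite -mulrA; apply: (le_trans (opnorm_ub S (T x))).
by rewrite ler_wpM2l ?opnorm_ge0 ?opnorm_ub.
Qed.

Let hnorm_opnorm T x : hnorm (T x) ^+ 2 <= opnorm (star T * T) * hnorm x ^+ 2.
Proof.
rewrite -re_norm /reinner adjointP -/(reinner x _) reC.
apply: (le_trans (re_CS _ _)).
rewrite expr2 mulrA ler_wpM2r ?hnorm_ge0//.
exact: (opnorm_ub (star T * T) x).
Qed.

Let opnorm_sqr_le T : opnorm T ^+ 2 <= opnorm (star T * T).
Proof.
rewrite -[leRHS]sqr_sqrtr ?opnorm_ge0// ler_sqr ?nnegrE ?opnorm_ge0 ?sqrtr_ge0//.
apply: opnorm_le => [|x]; first exact: sqrtr_ge0.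
rewrite -ler_sqr ?nnegrE ?mulr_ge0 ?hnorm_ge0 ?sqrtr_ge0//.
by rewrite exprMn sqr_sqrtr ?opnorm_ge0.
Qed.

Let opnorm_star_ge T : opnorm T <= opnorm (star T).
Proof.
have [->|T0] := eqVneq (opnorm T) 0; first exact: opnorm_ge0.
have {}T0 : 0 < opnorm T by rewrite lt_neqAle opnorm_ge0 eq_sym T0.
rewrite -(ler_pM2r T0) -expr2; apply: (le_trans (opnorm_sqr_le T)).
exact: opnormM.
Qed.

Fact opnorm_starM T : opnorm (star T * T) = opnorm T ^+ 2.
Proof.
apply/le_anti; rewrite opnorm_sqr_le andbT (le_trans (opnormM _ _))// expr2.
rewrite ler_wpM2r ?opnorm_ge0//.
by rewrite -[in leRHS](starK T) opnorm_star_ge.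
Qed.

Let le_eps (a b : R) : (forall e, 0 < e -> a <= b + e) -> a <= b.
Proof. by move=> h; apply/ler_addgt0Pr. Qed.

Fact opnorm_complete (u : nat -> 'B(H)) :
  (forall e : R, 0 < e -> exists N, forall m n : nat,
    (N <= m)%N -> (N <= n)%N -> opnorm (u m - u n) < e) ->
  exists T, opnorm (u n - T) @[n --> \oo] --> (0 : R).
Proof.
move=> uc.
have usub m n x : hnorm (u m x - u n x) <= opnorm (u m - u n) * hnorm x.
  by rewrite -bopNE -bopDE opnorm_ub.
have limx x : exists z, forall e : R, 0 < e -> exists N, forall n : nat,
    (N <= n)%N -> hnorm (u n x - z) < e.
  apply: hilbert_complete => e e0.
  have x1 : 0 < hnorm x + 1 by rewrite ltr_wpDl ?hnorm_ge0.
  have [N uN] := uc _ (divr_gt0 e0 x1); exists N => m n Nm Nn.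
  apply: (le_lt_trans (usub m n x)).
  apply: (@le_lt_trans _ _ (e / (hnorm x + 1) * hnorm x)).
    by rewrite ler_wpM2r ?hnorm_ge0// ltW// uN.
  by rewrite mulrAC ltr_pdivrMr// ltr_pM2l// ltrDl.
have [T TP] := boolp.choice limx.
have unif e : 0 < e -> exists N, forall n, (N <= n)%N ->
    forall x, hnorm (u n x - T x) <= e * hnorm x.
  move=> /uc[N uN]; exists N => n Nn x; apply: le_eps => d /(TP x)[K uK].
  have {}uK := uK _ (leq_maxr N K); have {}uN := uN n _ Nn (leq_maxl N K).
  rewrite -(subrK (u (maxn N K) x) (u n x)) -addrA.
  apply: (le_trans (hnorm_triangle _ _)); rewrite lerD// ?(ltW uK)//.
  by apply: (le_trans (usub _ _ _)); rewrite ler_wpM2r ?hnorm_ge0// ltW.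
have hnorm_tri x y z : hnorm (x - z) <= hnorm (x - y) + hnorm (y - z).
  by rewrite -[x - z](_ : (x - y) + (y - z) = _) ?hnorm_triangle// addrA subrK.
have Tlin : linear T.
  move=> l x y; apply/subr0_eq/hnorm0_eq0/le_anti; rewrite hnorm_ge0 andbT.
  apply: le_eps => e e0; rewrite add0r.
  set c := hnorm (l *: x + y) + (complex.Re `|l| * hnorm x + hnorm y) + 1.
  have c0 : 0 < c.
    by rewrite ltr_wpDl// !addr_ge0 ?mulr_ge0 ?hnorm_ge0.
  have [N uN] := unif _ (divr_gt0 e0 c0); have {}uN := uN _ (leqnn N).
  apply: (le_trans (hnorm_tri _ (u N (l *: x + y)) _)).
  rewrite -opprB hnorm_opp.
  have -> : u N (l *: x + y) - (l *: T x + T y) =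
      l *: (u N x - T x) + (u N y - T y).
    by rewrite bopD bopZ scalerBr opprD addrACA.
  have h1 := uN (l *: x + y); have h2 := uN x; have h3 := uN y.
  apply: (@le_trans _ _ (e / c * hnorm (l *: x + y) +
    (complex.Re `|l| * (e / c * hnorm x) + e / c * hnorm y))).
    apply: lerD => //; apply: (le_trans (hnorm_triangle _ _)); apply: lerD => //.
    by rewrite hnormZ ler_wpM2l.
  rewrite [leLHS](_ : _ = e / c * (c - 1)); last by rewrite /c; ring.
  by rewrite mulrAC ler_pdivrMr// ler_pM2l// gerBl.
have Tbd : bounded_linear T.
  split => //; have [N uN] := unif 1 ltr01.
  exists (1 + opnorm (u N)) => x; rewrite -(subrK (u N x) (T x)) mulrDl.
  apply: (le_trans (hnorm_triangle _ _)); rewrite lerD ?opnorm_ub//.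
  by rewrite -opprB hnorm_opp uN.
exists (BoundedOp Tbd); apply/cvgrPdist_le => e e0.
have [N uN] := unif e e0; exists N => // n /= Nn.
rewrite sub0r normrN ger0_norm ?opnorm_ge0//.
apply: opnorm_le => [|x]; first exact: ltW.
by rewrite bopDE bopNE uN.
Qed.

HB.instance Definition _ := isCStarAlgebra.Build R 'B(H)
  bop_scaleA bop_scale1 bop_scaleDr bop_scaleDl bop_scaleAl bop_scaleAr
  adjointZ opnormD opnormZ opnorm0_eq0 opnormM opnorm_starM opnorm_complete.
End BoundedOp.

(* Main.v *)
Require Import Defs.
From HB Require Import structures.
From mathcomp Require Import all_boot all_order all_algebra.
From mathcomp Require Import sesquilinear complex.
From mathcomp Require Import all_classical all_reals all_analysis.
From mathcomp Require Import lra.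

Set Implicit Arguments.
Unset Strict Implicit.
Unset Printing Implicit Defensive.

Import Order.TTheory GRing.Theory Num.Theory.
Import numFieldNormedType.Exports.

Local Open Scope classical_set_scope.
Local Open Scope ring_scope.

(** The defect Phi(ab) - Phi(a)Phi(b) does not change when scalars are subtracted
    from a and b, because Phi is unital, so it suffices to bound it by pq whenever
    |a| < p and |b| < q.  Writing a = x^*, apply Phi to the positive 3x3 matrix
    with entries x_i^* x_j, where (x_1, x_2, x_3) = (x, b, 1).  Eliminating the
    last row and column (the Schur complement) gives the Cauchy-Schwarz inequality
    for the defect, with the bounds Phi(x^*x) <= p^2 and Phi(b^*b) <= q^2.  These
    bounds hold because 1 - t has a self-adjoint square root when t = t^* and
    |t| < 1, by a fixed-point argument. *)

(** * Star-ring identities *)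

Section StarRing.
Variable A : starRingType.
Implicit Types x y : A.

Lemma starN x : star (- x) = - star x.
Proof. by apply: (addrI (star x)); rewrite -starD !subrr star0. Qed.

Lemma starB x y : star (x - y) = star x - star y.
Proof. by rewrite starD starN. Qed.

Lemma star1 : star (1 : A) = 1.
Proof. by rewrite -[RHS]starK -[X in _ = star X]mul1r starM starK mul1r. Qed.

Lemma star_mulmxE n (X Y : 'M[A]_n) i j :
  (star X * Y) i j = \sum_k star (X k i) * Y k j.
Proof. by rewrite /= mxE; apply: eq_bigr => k _; rewrite !mxE. Qed.

End StarRing.

(** * The norm of a C*-algebra *)

Section CNorm.
Variables (R : realType) (A : cstarAlgType R).
Implicit Types (x y z : A) (r : R).

Lemma cnormZ_real r x : cnorm (r%:C%C *: x) = `|r| * cnorm x.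
Proof. by rewrite cnormZ Re_norm_real. Qed.

Lemma cnorm0 : cnorm (0 : A) = 0.
Proof. by rewrite -(scale0r (0 : A)) (_ : 0 = 0%:C%C) // cnormZ_real normr0 mul0r. Qed.

Lemma cnormN x : cnorm (- x) = cnorm x.
Proof.
have N1 : -1 = (-1 : R)%:C%C by rewrite rmorphN1.
by rewrite -scaleN1r N1 cnormZ_real normrN1 mul1r.
Qed.

Lemma cnorm_ge0 x : 0 <= cnorm x.
Proof.
by have := cnormD x (- x); rewrite subrr cnorm0 cnormN -mulr2n pmulrn_lge0.
Qed.

Lemma cnorm_distC x y : cnorm (x - y) = cnorm (y - x).
Proof. by rewrite -cnormN opprB. Qed.

Lemma cnorm_dist_triangle y x z : cnorm (x - z) <= cnorm (x - y) + cnorm (y - z).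
Proof. by rewrite (_ : x - z = (x - y) + (y - z)) ?cnormD// addrA subrK. Qed.

(** The C*-identity and submultiplicativity bound [cnorm x ^+ 2] by [cnorm (star x) * cnorm x]; a
    nonzero [cnorm x] cancels. *)
Lemma cnorm_le_star x : cnorm x <= cnorm (star x).
Proof.
have [->|x0] := eqVneq (cnorm x) 0; first exact: cnorm_ge0.
have {}x0 : 0 < cnorm x by rewrite lt_neqAle eq_sym x0 cnorm_ge0.
by rewrite -(ler_pM2r x0) -expr2 -cnorm_starM cnormM.
Qed.

Lemma cnorm_star x : cnorm (star x) = cnorm x.
Proof.
by apply/le_anti; rewrite cnorm_le_star -{2}(starK x) cnorm_le_star.
Qed.

Lemma cnorm_sqrB x y :
  cnorm (x * x - y * y) <= (cnorm x + cnorm y) * cnorm (x - y).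
Proof.
have -> : x * x - y * y = x * (x - y) + (x - y) * y.
  by rewrite mulrBr mulrBl addrA subrK.
rewrite [leRHS]mulrDl (mulrC (cnorm y)).
by apply: (le_trans (cnormD _ _)); rewrite lerD ?cnormM.
Qed.

(** * A self-adjoint square root of [1 - t] *)

Section SquareRoot.
Variable t : A.
Hypotheses (t_sa : star t = t) (t_lt1 : cnorm t < 1).

(* The fixed points [s] of this map are the solutions of (1 - s)^2 = 1 - t; the
   map contracts the ball of radius [cnorm t]. *)
Let f x := (2^-1 : R)%:C%C *: (t + x * x).
Let u k := iter k f 0.

Let f_bound x : cnorm x <= cnorm t -> cnorm (f x) <= cnorm t.
Proof.
move=> xt; rewrite /f cnormZ_real ger0_norm ?invr_ge0//.
have := cnormD t (x * x); have := cnormM x x.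
have := cnorm_ge0 x; have := cnorm_ge0 t; have := t_lt1.
move: (cnorm _) (cnorm _) (cnorm _) (cnorm _) xt => *.
nra.
Qed.

Let f_contr x y : cnorm (f x - f y) <= 2^-1 * ((cnorm x + cnorm y) * cnorm (x - y)).
Proof.
rewrite /f -scalerBr cnormZ_real ger0_norm ?invr_ge0// ler_pM2l ?invr_gt0//.
by rewrite opprD addrACA subrr add0r cnorm_sqrB.
Qed.

Let u_bound k : cnorm (u k) <= cnorm t.
Proof. by elim: k => [|k IH]; [rewrite cnorm0 cnorm_ge0 | exact: f_bound]. Qed.

Let u_sa k : star (u k) = u k.
Proof.
elim: k => [|k IH]; first exact: star0.
by rewrite /u iterS -/(u k) /f starZ starD starM IH t_sa conjc_real.
Qed.

(** All iterates lie in the ball of radius [cnorm t], where [f_contr] has Lipschitz constant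
    [cnorm t]; the ball has diameter at most 2, which starts the induction. *)
Let u_close N m n : (N <= m)%N -> (N <= n)%N ->
  cnorm (u m - u n) <= 2 * cnorm t ^+ N.
Proof.
elim: N m n => [|N IH] [|m] [|n] // h1 h2.
- by rewrite subrr cnorm0 expr0 mulr1.
- by rewrite sub0r cnormN; apply: (le_trans (u_bound n.+1)); have := t_lt1; lra.
- by rewrite subr0; apply: (le_trans (u_bound m.+1)); have := t_lt1; lra.
- apply: (le_trans (cnormD _ _)); rewrite cnormN expr0.
  by have := u_bound m.+1; have := u_bound n.+1; have := t_lt1; lra.
apply: (le_trans (f_contr (u m) (u n))).
have := IH m n h1 h2; have := u_bound m; have := u_bound n.
have := cnorm_ge0 t; have := cnorm_ge0 (u m - u n).
rewrite exprS; move: (cnorm (_ - _)) (cnorm t) (cnorm (u m)) (cnorm (u n)).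
move=> d c v w d0 c0 wc vc dq.
have : (v + w) * d <= (c + c) * d by rewrite ler_wpM2r// lerD.
have : c * d <= c * (2 * c ^+ N) by rewrite ler_wpM2l.
lra.
Qed.

Lemma positive_one_sub : positive (1 - t).
Proof.
have t0 := cnorm_ge0 t.
have /cnorm_complete[s us] : forall e : R, 0 < e -> exists N, forall m n : nat,
    (N <= m)%N -> (N <= n)%N -> cnorm (u m - u n) < e.
  move=> e e0.
  have : (2 * cnorm t ^+ n @[n --> \oo] --> (0 : R))%classic.
    by have := @cvg_geometric R 2 (cnorm t); rewrite ger0_norm//; apply.
  move=> /cvgr0Pnorm_lt /(_ e e0)[N _ uN]; exists N => m n Nm Nn.
  apply: (le_lt_trans (u_close Nm Nn)).
  by apply: le_lt_trans (uN N (leqnn N)); exact: ler_norm.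
have {}us e : 0 < e -> exists N, forall n, (N <= n)%N -> cnorm (u n - s) < e.
  move=> e0; move/cvgr0Pnorm_lt: us => /(_ e e0)[N _ uN]; exists N => n Nn.
  by apply: le_lt_trans (uN n Nn); exact: ler_norm.
have eq0 z (C : R) : (forall e : R, 0 < e -> e <= 1 -> cnorm z <= C * e) -> z = 0.
  move=> h; apply: cnorm0_eq0; apply/le_anti; rewrite cnorm_ge0 andbT.
  apply/ler_addgt0Pr => e e0; rewrite add0r.
  have C1 : 0 < `|C| + 1 by rewrite ltr_wpDl.
  have [|le1] := leP 1 (e / (`|C| + 1)).
    rewrite ler_pdivlMr// mul1r => Ce.
    by apply: (le_trans (h 1 _ _)) => //; have := ler_norm C; lra.
  have d0 : 0 < e / (`|C| + 1) by rewrite divr_gt0.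
  apply: (le_trans (h _ d0 (ltW le1))).
  rewrite mulrA ler_pdivrMr// mulrC ler_pM2l//.
  by have := ler_norm C; lra.
have s_sa : star s = s.
  apply/subr0_eq/(eq0 _ 2) => e e0 _; have [N /(_ N (leqnn N)) uN] := us e e0.
  apply: (le_trans (cnorm_dist_triangle (u N) _ _)).
  rewrite -[X in star s - X]u_sa -starB cnorm_star (cnorm_distC s). lra.
have s_fix : s = f s.
  (* Since [e <= 1], [cnorm s < 2], so [f] at most doubles the distance from [u N] to [s]. Hence 3 =
     1 + 2, the 1 coming from the distance of [u N.+1] to [s]. *)
  apply/subr0_eq/(eq0 _ 3) => e e0 e1.
  have [N uN] := us e e0.
  have uN0 := uN N (leqnn N); have uN1 := uN N.+1 (leqnSn N).
  apply: (le_trans (cnorm_dist_triangle (u N.+1) _ _)).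
  rewrite cnorm_distC.
  have := f_contr (u N) s.
  have := cnormD (u N) (s - u N); rewrite addrC subrK [in X in X -> _]cnorm_distC.
  have := u_bound N; have := cnorm_ge0 (u N - s); have := t_lt1.
  rewrite -[f (u N)]/(u N.+1).
  move: (cnorm (u N.+1 - s)) (cnorm (u N - s)) uN0 uN1 => a b ha hb.
  move: (cnorm t) (cnorm (u N)) (cnorm s) (cnorm (_ - _)) => c v w x *.
  have : (v + w) * b <= 4 * b by rewrite ler_wpM2r//; lra.
  lra.
exists (1 - s); rewrite starB s_sa star1 mulrBl mul1r mulrBr mulr1.
have : s + s = t + s * s.
  rewrite {1 2}s_fix /f -scalerDl -rmorphD/=.
  by rewrite (_ : 2^-1 + 2^-1 = 1 :> R) ?scale1r//; lra.
move=> ss; have -> : t = s + s - s * s by rewrite ss addrK.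
by rewrite !opprB [s * s - (s + s)]addrC opprD !addrA [RHS]addrAC.
Qed.
End SquareRoot.
End CNorm.

(** * Gram matrices under an n-positive map *)

Section Gram.
Variables (A B : starRingType) (n : nat) (f : A -> B).
Hypothesis f_pos : n_positive n f.

(** If [X] has first row [x], padded by zeros, and all other rows zero, then [star X * X] contains
    the Gram matrix of [x]. Its image factors as [star C * C], and [c] consists of the first [m]
    columns of [C]. The padding covers every [m <= n]. *)
Lemma n_positive_gram m (x : 'I_m -> A) : (m <= n)%N ->
  exists c : 'I_n -> 'I_m -> B,
    forall i j, f (star (x i) * x j) = \sum_k star (c k i) * c k j.
Proof.
move=> mn.
pose X : 'M[A]_n := \matrix_(i, j) if i == 0%N :> nat then oapp x 0 (insub (j : nat)) else 0.
have [C CE] := f_pos (ex_intro _ X erefl).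
exists (fun k i => C k (widen_ord mn i)) => i j.
have := congr1 (fun M : 'M[B]_n => M (widen_ord mn i) (widen_ord mn j)) CE.
rewrite mxE !star_mulmxE.
have n0 : (0 < n)%N by apply: leq_trans mn; case: i => i /=; case: (m).
have Xx (k : 'I_m) : X (Ordinal n0) (widen_ord mn k) = x k.
  by rewrite mxE /= valK.
rewrite (bigD1 (Ordinal n0))//= big1 ?addr0 => [|k k0].
  by rewrite !Xx.
rewrite [X k (widen_ord _ j)]mxE.
suff -> : (k == 0%N :> nat) = false by rewrite mulr0.
by apply/negbTE; apply: contra_neq k0 => k0; exact: val_inj.
Qed.

(** In the image of the Gram matrix of [(x, 1)], which is self-adjoint, [f (star x)] and [f x] are
    opposite off-diagonal entries. *)
Lemma n_positive_star x : (2 <= n)%N -> f (star x) = star (f x).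
Proof.
move=> n2; have [c cE] := n_positive_gram (fun i : 'I_2 => [:: x; 1]`_i) n2.
have := cE ord0 ord_max; have := cE ord_max ord0.
rewrite /= star1 mulr1 mul1r => -> ->; rewrite star_sum.
by apply: eq_bigr => k _; rewrite starM starK.
Qed.

End Gram.

(** * Real inner products and operators *)

Section Hilbert.
Variables (R : realType) (H : hilbertType R).
Implicit Types (S T : 'B(H)) (u v w : H).

Lemma reinner0l v : reinner 0 v = 0.
Proof. by rewrite -(subrr v) reDl reNl subrr. Qed.

Lemma reinner_suml I r (P : pred I) (F : I -> H) v :
  reinner (\sum_(i <- r | P i) F i) v = \sum_(i <- r | P i) reinner (F i) v.
Proof.
exact: (big_morph (fun u => reinner u v) (fun u w => reDl u w v) (reinner0l v)).
Qed.

Lemma reinner_sumr I r (P : pred I) (F : I -> H) v :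
  reinner v (\sum_(i <- r | P i) F i) = \sum_(i <- r | P i) reinner v (F i).
Proof. by rewrite reC reinner_suml; apply: eq_bigr => i _; rewrite reC. Qed.

Lemma bop_sumE I r (P : pred I) (F : I -> 'B(H)) v :
  (\sum_(i <- r | P i) F i) v = \sum_(i <- r | P i) F i v.
Proof. by apply: (big_morph (fun T : 'B(H) => T v)). Qed.

Lemma reinner_starl T u v : reinner (star T u) v = reinner u (T v).
Proof. by rewrite /reinner adjointPr. Qed.

Lemma opnorm_le_reinner T (M : R) : 0 <= M ->
  (forall v, hnorm (T v) ^+ 2 <= M ^+ 2 * hnorm v ^+ 2) -> cnorm T <= M.
Proof.
move=> M0 TM; apply: opnorm_le => // v.
by rewrite -ler_sqr ?nnegrE ?mulr_ge0 ?hnorm_ge0// exprMn.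
Qed.

End Hilbert.

(** * Inequalities for unital n-positive maps *)

Section NPositive.
Variables (R : realType) (A : cstarAlgType R) (H : hilbertType R) (n : nat).
Variable Phi : {linear A -> 'B(H)}.
Hypothesis Phi_pos : n_positive n Phi.

(** The Gram factorisation turns this quadratic form into a sum of squared norms. *)
Lemma n_positive_reinner m (x : 'I_m -> A) (h : 'I_m -> H) : (m <= n)%N ->
  0 <= \sum_i \sum_j reinner (Phi (star (x i) * x j) (h j)) (h i).
Proof.
move=> mn; have [c cE] := n_positive_gram Phi_pos x mn.
suff -> : \sum_i \sum_j reinner (Phi (star (x i) * x j) (h j)) (h i) =
    \sum_k hnorm (\sum_i c k i (h i)) ^+ 2.
  by apply: sumr_ge0 => k _; exact: sqr_ge0.
under [RHS]eq_bigr => k _.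
  rewrite -re_norm reinner_sumr.
  under eq_bigr => i _ do rewrite reinner_suml.
  over.
rewrite [RHS]exchange_big; apply: eq_bigr => i _ /=.
rewrite [RHS]exchange_big; apply: eq_bigr => j _ /=.
rewrite cE bop_sumE reinner_suml; apply: eq_bigr => k _.
by rewrite bopME reinner_starl.
Qed.

Hypothesis Phi1 : Phi 1 = 1.

(** Scaling [star x * x] by [p ^- 2] gives norm below 1, so [1 - t] is some [star b * b], and
    [Phi (1 - t) = 1 - Phi t] has a nonnegative form. *)
Lemma unital_n_positive_contraction x (p : R) (h : H) : (0 < n)%N ->
  cnorm x < p -> reinner (Phi (star x * x) h) h <= p ^+ 2 * hnorm h ^+ 2.
Proof.
move=> n0 xp; have p0 : 0 < p by exact: le_lt_trans (cnorm_ge0 x) xp.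
have p20 : 0 < p ^+ 2 by rewrite exprn_gt0.
pose t := (p ^- 2)%:C%C *: (star x * x).
have [||b bE] := @positive_one_sub _ _ t.
- by rewrite starZ starM starK conjc_real.
- rewrite cnormZ_real cnorm_starM ger0_norm ?invr_ge0 ?(ltW p20)//.
  by rewrite mulrC ltr_pdivrMr// mul1r ltr_pXn2r ?nnegrE ?cnorm_ge0 ?(ltW p0).
have := @n_positive_reinner 1 (fun=> b) (fun=> h) n0.
rewrite !big_ord_recl !big_ord0 !addr0 -bE linearB Phi1 linearZ/=.
rewrite scaleN1r reDl reNl reZl re_norm subr_ge0.
by rewrite mulrC ler_pdivrMr// mulrC.
Qed.

(* Positivity is tested on (x, y, 1), with the vector at the entry 1 chosen as
   for the Schur complement of that entry. *)
Lemma unital_n_positive_reinner x y (p q : R) (h k : H) : (3 <= n)%N ->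
  cnorm x < p -> cnorm y < q ->
  - (2 * reinner ((Phi (star x * y) - star (Phi x) * Phi y) k) h) <=
    p ^+ 2 * hnorm h ^+ 2 + q ^+ 2 * hnorm k ^+ 2.
Proof.
move=> n3 xp yq; have n2 := ltnW n3.
rewrite bopDE bopNE bopME reDl reNl reinner_starl.
pose g := - (Phi x h + Phi y k).
have := @n_positive_reinner 3 (fun i => [:: x; y; 1]`_i)
  (fun i => [:: h; k; g]`_i) n3.
rewrite !big_ord_recl !big_ord0 /= star1 !mulr1 !mul1r !addr0 Phi1 bop1E.
have -> : star y * x = star (star x * y) by rewrite starM starK.
rewrite !(n_positive_star Phi_pos _ n2) !reinner_starl.
have := unital_n_positive_contraction h (ltnW n2) xp.
have := unital_n_positive_contraction k (ltnW n2) yq.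
rewrite /g !(reDl, reDr, reNl, reNr).
rewrite (reC h) (reC (Phi y k) (Phi x h)).
(* Expanding the square of [g] leaves these two squares with a minus sign; they are dropped. *)
have := sqr_ge0 (hnorm (Phi x h)); have := sqr_ge0 (hnorm (Phi y k)).
rewrite -!re_norm; lra.
Qed.

Lemma unital_n_positive_star_bound x y (p q : R) : (3 <= n)%N ->
  cnorm x < p -> cnorm y < q ->
  cnorm (Phi (star x * y) - star (Phi x) * Phi y) <= p * q.
Proof.
move=> n3 xp yq; have p0 : 0 < p by exact: le_lt_trans (cnorm_ge0 x) xp.
have q0 : 0 < q by exact: le_lt_trans (cnorm_ge0 y) yq.
apply: opnorm_le_reinner => [|k]; first by rewrite mulr_ge0// ltW.
have p20 : 0 < p ^+ 2 by rewrite exprn_gt0.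
(* With [D] the defect, this vector minimises [p ^+ 2 * hnorm h ^+ 2 + 2 * reinner (D k) h] over
   [h]; the minimum is [- p ^- 2 * hnorm (D k) ^+ 2]. *)
have := unital_n_positive_reinner ((- p ^- 2)%:C%C *:
  (Phi (star x * y) - star (Phi x) * Phi y) k) k n3 xp yq.
move: (_ - _) => D.
rewrite reZr re_norm hnormZ Re_norm_real normrN exprMn real_normK ?num_real//.
rewrite (mulrA (p ^+ 2)) expr2 (mulrA (p ^+ 2)) mulfV ?gt_eqF// mul1r.
rewrite mulNr mulrN opprK mulr_natl mulr2n lerD2l.
by rewrite mulrC ler_pdivrMr// mulrC mulrA exprMn.
Qed.

Lemma unital_defect_shiftl l x y :
  Phi ((x - l *: (1 : A)) * y) - Phi (x - l *: (1 : A)) * Phi y =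
    Phi (x * y) - Phi x * Phi y.
Proof.
have -> : Phi (x - l *: (1 : A)) = Phi x - l *: (1 : 'B(H)).
  by rewrite linearB -Phi1; congr (_ - _); exact: linearZ.
have -> : Phi ((x - l *: (1 : A)) * y) = Phi (x * y) - l *: Phi y.
  by rewrite mulrBl -cscalerAl mul1r linearB; congr (_ - _); exact: linearZ.
move: (Phi _) (Phi _) (Phi _) => S T U.
by rewrite [X in _ - X = _]mulrBl -bop_scaleAl mul1r opprB addrA subrK.
Qed.

Lemma unital_defect_shiftr l x y :
  Phi (x * (y - l *: (1 : A))) - Phi x * Phi (y - l *: (1 : A)) =
    Phi (x * y) - Phi x * Phi y.
Proof.
have -> : Phi (y - l *: (1 : A)) = Phi y - l *: (1 : 'B(H)).
  by rewrite linearB -Phi1; congr (_ - _); exact: linearZ.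
have -> : Phi (x * (y - l *: (1 : A))) = Phi (x * y) - l *: Phi x.
  by rewrite mulrBr -cscalerAr mulr1 linearB; congr (_ - _); exact: linearZ.
move: (Phi _) (Phi _) (Phi _) => S T U.
by rewrite [X in _ - X = _]mulrBr -bop_scaleAr mulr1 opprB addrA subrK.
Qed.

End NPositive.

(** * Passage to the infimum over scalars *)

Theorem theorem2p6 (R : realType) (A : cstarAlgType R) (H : hilbertType R)
    (n : nat) (Phi : {linear A -> 'B(H)}) :
  (3 <= n)%N -> Phi 1 = 1 -> n_positive n Phi ->
  forall a b : A, cnorm (Phi (a * b) - Phi a * Phi b) <= Delta a * Delta b.
Proof.
move=> n3 Phi1 Phi_pos a b.
have dist_ex (c : A) (e : R) : 0 < e -> exists l : R[i], cnorm (c - l *: (1 : A)) < Delta c + e.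
  move=> e0; have c_inf : has_inf [set cnorm (c - l *: (1 : A)) | l in [set: R[i]]].
    split; first by exists (cnorm (c - 0 *: (1 : A))), 0.
    by exists 0 => _ [l _ <-]; exact: cnorm_ge0.
  by have [_ [l _ <-] cl] := inf_adherent e0 c_inf; exists l.
have Delta_ge0 (c : A) : 0 <= Delta c.
  apply: lb_le_inf; first by exists (cnorm (c - 0 *: (1 : A))), 0.
  by move=> _ [l _ <-]; exact: cnorm_ge0.
have bound e : 0 < e ->
    cnorm (Phi (a * b) - Phi a * Phi b) <= (Delta a + e) * (Delta b + e).
  move=> e0; have [l al] := dist_ex a e e0; have [m bm] := dist_ex b e e0.
  (* The bound concerns products [star x * y], so the shifted [a] enters as the star of its own
     star. *)
  have xl : cnorm (star (a - l *: (1 : A))) < Delta a + e by rewrite cnorm_star.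
  have := unital_n_positive_star_bound Phi_pos Phi1 n3 xl bm.
  rewrite -(n_positive_star Phi_pos _ (ltnW n3)) starK.
  by rewrite unital_defect_shiftl// unital_defect_shiftr.
move: (cnorm _) (Delta a) (Delta b) (Delta_ge0 a) (Delta_ge0 b) bound.
move=> c p q p0 q0 bound; apply/ler_addgt0Pr => e e0.
have s0 : 0 < p + q + 1 + e by lra.
(* The summand [e] in the denominator forces [d <= 1], so [(p + d) * (q + d)] is at most
   [p * q + d * (p + q + 1)], hence at most [p * q + e]. *)
pose d := e / (p + q + 1 + e).
have d0 : 0 < d by rewrite divr_gt0.
have d1 : d <= 1 by rewrite ler_pdivrMr// mul1r; lra.
have dE : d * (p + q + 1 + e) = e by rewrite mulfVK ?gt_eqF.
apply: (le_trans (bound d d0)).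
have : d * d <= d by rewrite ler_piMl// ltW.
have : 0 <= d * e by rewrite mulr_ge0// ltW.
rewrite !mulrDl !mulrDr (mulrC p d); lra.
Qed.
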